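(* For any real speedup $s$ with $2\le s\le 4$, algorithm SPEEDUP (run with speed $s$) returns a service run traveling at speed $s$ whose total profit is at least $\frac{s}{4\gamma}\,\mathrm{profit}(R^* )$, where $R^*$ is a maximum-profit unit-speed service run for the original untrimmed windows; i.e. SPEEDUP is a $4\gamma/s$-approximation to the traveling repairman problem with unit-time windows. Its running time is $O(\min\{r,m\}\,\Gamma(n))$, where $s=q/r$ in lowest terms if $s$ is rational and $r=\infty$ if $s$ is irrational.
   Context: Problem: an undirected graph with metric edge lengths (either a tree or a general metric graph) on $n$ nodes, and $m$ service requests; request $i$ is located at a node $v_i$, has a nonnegative profit, and has a time window $[w_i,w_i+1)$ of unit length. A service run at speed $\sigma$ is a route that may start at any node at any time (unrooted) and covers distance at most $\sigma t$ in any time interval of length $t$; it earns the profit of request $i$ (at most once) if it is at $v_i$ at some time in the window of request $i$. $R^*$ is a speed-$1$ service run of maximum total profit for the untrimmed windows. Trimming with offset $h$: periods $[h+j/2,h+(j+1)/2)$, $j\in\mathbb{Z}$; assuming (after a slight perturbation if necessary) that no window starts on a period boundary, each window contains exactly one period entirely and is replaced by it. REPAIR: an algorithm that, given a trimmed instance and speed $\sigma$, returns in time $\Gamma(n)$ a speed-$\sigma$ run whose profit on the trimmed windows is at least $1/\gamma$ times the maximum such profit of any speed-$\sigma$ run; $\gamma=1$, $\Gamma(n)=O(n^4)$ for trees, and $\gamma=2+\epsilon$, $\Gamma(n)=O(n^{O(1/\epsilon^2)})$ for metric graphs. CANONICAL offsets: for each window start $t_i$ let $a_i$ be the largest integer with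 $a_i/2<t_i$, $h_i=t_i-a_i/2$; sort $h_1\le\dots\le h_m$; the offsets are $0$ and $(h_{i-1}+h_i)/2$ for $i=2,\dots,m$. SPEEDUP with speed $s$: if $s=q/r$ is rational in lowest terms with $r<m$, use the $r$ offsets spread uniformly in $[0,1/2)$, namely $(i-1)/(2r)$ for $i=1,\dots,r$; otherwise use the CANONICAL offsets. For each offset, trim the windows, run REPAIR at speed $s$ on the trimmed instance, and return the best run found. A $\rho$-approximation returns a run of profit at least $\mathrm{profit}(R^* )/\rho$.
   Formalization: The running-time bound is stated for m ≥ 1 and for m at most a given function M(n), with REPAIR taking at least m steps (to read its input) and at most Γ(n) when m ≤ M(n); for m unbounded in n the bound would fail, since trimming alone takes m steps. *)

(* Defs.v *)
From HB Require Import structures.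
From mathcomp Require Import all_boot all_order all_algebra.
From mathcomp Require Import boolp reals.
From mathcomp Require Import lra.

Set Implicit Arguments.
Unset Strict Implicit.
Unset Printing Implicit Defensive.

Import Order.TTheory GRing.Theory Num.Theory.
Local Open Scope ring_scope.

Fixpoint walk_length (R : realType) (V : Type) (len : V -> V -> R)
    (u : V) (p : seq V) : R :=
  if p is v :: p' then len u v + walk_length len v p' else 0.

Record metric_graph (R : realType) := MetricGraph {
  vertex : finType;
  adj : rel vertex;
  len : vertex -> vertex -> R;
  vertex_gt0 : (0 < #|vertex|)%N;
  adj_sym : symmetric adj;
  adj_irrefl : irreflexive adj;
  len_sym : forall u v, adj u v -> len u v = len v u;
  len_gt0 : forall u v, adj u v -> 0 < len u v;
  (* Triangle inequality: an edge is never longer than a detour. *)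
  len_metric : forall u p, path adj u p -> adj u (last u p) ->
    len u (last u p) <= walk_length len u p
}.

Definition is_tree (R : realType) (G : metric_graph R) : Prop :=
  (forall u v : vertex G, connect (@adj R G) u v) /\
  (* A 2-cycle u, v is the edge uv traversed back and forth. *)
  (forall c : seq (vertex G), ucycle (@adj R G) c -> (size c <= 2)%N).

Inductive graph_class := Trees | MetricGraphs.

Definition in_class (R : realType) (cls : graph_class) (G : metric_graph R) : Prop :=
  match cls with Trees => is_tree G | MetricGraphs => True end.

(* A location on the graph; [InEdge u v x _ _] is the interior point of the
   edge uv at distance x from u, which is also [InEdge v u (len u v - x) _ _]. *)
Inductive point (R : realType) (G : metric_graph R) :=
| AtNode of vertex G
| InEdge (u v : vertex G) (x : R) of adj u v & 0 < x < len u v.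

(* The nodes through which a point is left, with their distance to it. *)
Definition exits (R : realType) (G : metric_graph R) (p : point G) :
    seq (vertex G * R) :=
  match p with
  | AtNode v => [:: (v, 0)]
  | InEdge u v x _ _ => [:: (u, x); (v, len u v - x)]
  end.

Definition along_edge (R : realType) (G : metric_graph R) (p q : point G)
    (d : R) : Prop :=
  match p, q with
  | InEdge u v x _ _, InEdge u' v' x' _ _ =>
      [/\ u = u', v = v' & `|x - x'| <= d] \/
      [/\ u = v', v = u' & `|x - (len u v - x')| <= d]
  | _, _ => False
  end.

(* The distance of p and q in the graph, seen as a length space, is at most d. *)
Definition dist_le (R : realType) (G : metric_graph R) (p q : point G)
    (d : R) : Prop :=
  along_edge p q d \/
  exists e e' w, [/\ e \in exits p, e' \in exits q,
    path (@adj R G) e.1 w /\ last e.1 w = e'.1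
    & e.2 + walk_length (@len R G) e.1 w + e'.2 <= d].

Record request (R : realType) (G : metric_graph R) := Request {
  node : vertex G;
  gain : R;
  opening : R;
  closing : R
}.

(* The positions before [start] are irrelevant; a run that ends stays put. *)
Record run (R : realType) (G : metric_graph R) := Run {
  start : R;
  pos : R -> point G
}.

(* Since the graph is a length space, the Lipschitz condition bounds the
   distance travelled, not just the displacement, over every time interval. *)
Definition has_speed (R : realType) (G : metric_graph R) (sigma : R)
    (rho : run G) : Prop :=
  (exists v, pos rho (start rho) = AtNode v) /\
  forall t t', start rho <= t -> t <= t' ->
    dist_le (pos rho t) (pos rho t') (sigma * (t' - t)).

Definition serviced (R : realType) (G : metric_graph R) (rho : run G)
    (q : request G) : Prop :=
  exists t, [/\ start rho <= t, opening q <= t < closing q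
              & pos rho t = AtNode (node q)].

Definition profit (R : realType) (G : metric_graph R) (reqs : seq (request G))
    (rho : run G) : R :=
  \sum_(q <- reqs) if `[< serviced rho q >] then gain q else 0.

Definition optimal (R : realType) (G : metric_graph R) (reqs : seq (request G))
    (sigma : R) (rho : run G) : Prop :=
  has_speed sigma rho /\
  forall rho', has_speed sigma rho' -> profit reqs rho' <= profit reqs rho.

Definition unit_windows (R : realType) (G : metric_graph R)
    (reqs : seq (request G)) : bool :=
  all (fun q => (0 <= gain q) && (closing q == opening q + 1)) reqs.

Definition boundary (R : realType) (h : R) (j : int) : R := h + j%:~R / 2.

Definition trimmed (R : realType) (G : metric_graph R)
    (reqs : seq (request G)) : Prop :=
  exists h : R, all (fun q =>
    [&& 0 <= gain q, (opening q - h) * 2 \is a Num.int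
      & closing q == opening q + 1 / 2]) reqs.

(* The least j such that period j of offset h starts no earlier than w. *)
Definition period_index (R : realType) (h w : R) : int :=
  Num.ceil ((w - h) * 2).

Definition trim (R : realType) (G : metric_graph R) (h : R) (q : request G) :
    request G :=
  let j := period_index h (opening q) in
  Request (node q) (gain q) (boundary h j) (boundary h (j + 1)).

(* A window [w, w + 1) that starts off the boundaries contains exactly one
   period, the one of index [period_index h w].  If w is a boundary, it contains
   two, and [trim] keeps the first one, as if the window were moved to start
   slightly earlier. *)
Lemma period_index_sub (R : realType) (h w : R) (j := period_index h w) :
  w <= boundary h j /\ boundary h (j + 1) <= w + 1.
Proof.
have := ceil_itv ((w - h) * 2); rewrite -/(period_index h w) -/j /boundary.
by rewrite !intrD rmorphN /= => /andP[lo hi]; split; lra.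
Qed.

Lemma period_index_unique (R : realType) (h w : R) (j : int) :
  (forall i : int, w != boundary h i) ->
  w <= boundary h j -> boundary h (j + 1) <= w + 1 -> j = period_index h w.
Proof.
move=> off lo hi; apply/esym/ceil_def; have := off (j - 1); move: lo hi.
rewrite /boundary !intrD !rmorphN /= => lo hi /negP neq.
have: w <> h + (j%:~R + -1) / 2 by move=> e; apply: neq; apply/eqP.
move=> /eqP; rewrite neq_lt => /orP[]; lra.
Qed.

(* Programs with their running time: a result with the number of elementary
   steps.  The model is a real RAM: a step is a bounded number of arithmetic
   operations, comparisons and roundings of reals. *)

Definition timed (A : Type) : Type := A * nat.

Definition ret (A : Type) (a : A) : timed A := (a, 0%N).

Definition bind (A B : Type) (c : timed A) (f : A -> timed B) : timed B :=
  ((f c.1).1, (c.2 + (f c.1).2)%N).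

Definition step (A : Type) (a : A) : timed A := (a, 1%N).

Notation "'let!' x := c 'in' k" := (bind c (fun x => k))
  (at level 200, x name, c at level 200, k at level 200).

(* Only used with an f that takes one step. *)
Fixpoint tmap (A B : Type) (f : A -> B) (s : seq A) : timed (seq B) :=
  if s is a :: s' then
    let! b := step (f a) in
    let! bs := tmap f s' in
    ret (b :: bs)
  else ret [::].

Fixpoint tinsert (R : realType) (x : R) (s : seq R) : timed (seq R) :=
  if s is y :: s' then
    let! le_xy := step (x <= y) in
    if le_xy then ret (x :: s)
    else let! s1 := tinsert x s' in ret (y :: s1)
  else step [:: x].

Fixpoint tsort (R : realType) (s : seq R) : timed (seq R) :=
  if s is x :: s' then let! s1 := tsort s' in tinsert x s1
  else ret [::].

(* The algorithm is given a trimmed instance and a speed; it returns a run and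
   the profit of this run. *)
Definition repair_algorithm (R : realType) : Type :=
  forall G : metric_graph R, seq (request G) -> R -> timed (run G * R).

Definition repair_approximates (R : realType) (cls : graph_class) (gamma : R)
    (repair : repair_algorithm R) : Prop :=
  forall (G : metric_graph R) (reqs : seq (request G)) (sigma : R),
    in_class cls G -> trimmed reqs -> 0 < sigma ->
    let out := (repair G reqs sigma).1 in
    [/\ has_speed sigma out.1,
        out.2 = profit reqs out.1
      & forall rho, has_speed sigma rho ->
          profit reqs rho / gamma <= profit reqs out.1].

(* [Gamma n] bounds the running time on n nodes.  As reading the requests takes
   one step each, such a bound presupposes a bound [M n] on their number. *)
Definition repair_runs_in (R : realType) (cls : graph_class)
    (M Gamma : nat -> nat) (repair : repair_algorithm R) : Prop :=
  forall (G : metric_graph R) (reqs : seq (request G)) (sigma : R),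
    in_class cls G -> trimmed reqs -> 0 < sigma ->
    let time := (repair G reqs sigma).2 in
    (size reqs <= time)%N /\
    ((size reqs <= M #|vertex G|)%N -> (time <= Gamma #|vertex G|)%N).

(* The least r' in [r, r + k) such that s * r' is an integer. *)
Fixpoint find_den (R : realType) (s : R) (r k : nat) : timed (option nat) :=
  if k is k'.+1 then
    let! is_den := step (s * r%:R \is a Num.int) in
    if is_den then ret (Some r) else find_den s r.+1 k'
  else ret None.

Lemma int_mul_ratr (R : realType) (x : rat) (k : nat) :
  ((ratr x : R) * k%:R \is a Num.int) = (`|denq x| %| k)%N.
Proof.
have -> : ratr x * k%:R = ratr (x * k%:R) :> R by rewrite rmorphM /= ratr_nat.
have den0 : (denq x)%:~R != 0 :> rat by rewrite intr_eq0 denq_neq0.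
apply/intrP/idP => [[z] | /dvdnP[l ->]].
  rewrite -(ratr_int R z) => /fmorph_inj e.
  have {}e : numq x * k%:Z = z * denq x.
    apply: (@intr_inj rat); rewrite !rmorphM /= -e numqE -pmulrn.
    by rewrite mulrAC.
  rewrite -(@Gauss_dvdr _ `|numq x|) 1?coprime_sym ?coprime_num_den //.
  by apply/dvdnP; exists `|z|%N; rewrite -[k]/(absz k%:Z) -!abszM e.
exists (numq x * l%:Z); rewrite -(ratr_int R); congr (ratr _).
rewrite natrM mulrCA -[(`|denq x|)%:R]/((`|denq x|%:Z)%:~R) absz_denq.
by rewrite rmorphM /= numqE mulrC.
Qed.

Lemma find_den_some (R : realType) (s : R) (r k d : nat) :
  (find_den s r k).1 = Some d <->
  [/\ (r <= d < r + k)%N, s * d%:R \is a Num.int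
    & forall e, (r <= e < d)%N -> s * e%:R \isn't a Num.int].
Proof.
elim: k r => [|k IH] r /=.
  by split=> // -[]; rewrite addn0 => /andP[rd /(leq_ltn_trans rd)]; rewrite ltnn.
case: ifP => sr /=.
  split=> [[<-] | [/andP[rd _] sd mind]].
    split=> //; first by rewrite leqnn addnS ltnS leq_addr.
    by move=> e /andP[re /(leq_ltn_trans re)]; rewrite ltnn.
  move: rd; rewrite leq_eqVlt => /predU1P[-> // | rd].
  by have := mind r; rewrite leqnn rd sr => /(_ isT).
split=> [/IH[/andP[rd dk] sd mind] | [/andP[rd dk] sd mind]].
  split=> //; first by rewrite ltnW //= -addSnnS.
  move=> e /andP[]; rewrite leq_eqVlt => /predU1P[<- _ | re ed].
    by rewrite sr.
  by apply: mind; rewrite re.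
apply/IH; split=> //.
- rewrite addSnnS dk andbT ltn_neqAle rd andbT.
  by apply: contraTneq sd => <-; rewrite sr.
- by move=> e /andP[re ed]; apply: mind; rewrite ltnW.
Qed.

Lemma find_denP (R : realType) (s : R) (m r : nat) :
  (find_den s 1 m.-1).1 = Some r <->
  (r < m)%N /\ exists x : rat, s = ratr x /\ denq x = r%:Z.
Proof.
split=> [/find_den_some[/andP[r0 rm] sr minr] | [rm [x [-> xr]]]].
  have {}rm : (r < m)%N by case: m rm => //=; rewrite ltnNge r0.
  split=> //; have /intrP[z sz] := sr.
  have r_neq0 : r%:R != 0 :> R by rewrite pnatr_eq0 -lt0n.
  pose x : rat := z%:~R / r%:R.
  have sx : s = ratr x.
    by rewrite fmorph_div /= ratr_int ratr_nat -sz mulfK.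
  exists x; split=> //; move: sr; rewrite sx int_mul_ratr => dr.
  apply/eqP; rewrite -absz_denq eqz_nat eqn_leq dvdn_leq //= leqNgt.
  apply/negP => ltr; have := minr `|denq x|%N.
  by rewrite ltr absz_gt0 denq_neq0 sx int_mul_ratr dvdnn => /(_ isT).
have xr' : `|denq x|%N = r by rewrite xr.
have r0 : (0 < r)%N by rewrite -xr' absz_gt0 denq_neq0.
apply/find_den_some; split.
- by rewrite r0 add1n prednK // (leq_ltn_trans _ rm).
- by rewrite int_mul_ratr xr'.
- move=> e /andP[e0 er]; rewrite int_mul_ratr xr'.
  by apply/negP => /(dvdn_leq e0); rewrite leqNgt er.
Qed.

(* Nonempty sequences of offsets are given by their head and tail. *)

Definition uniform_offsets (R : realType) (r : nat) : timed (R * seq R) :=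
  let! cs := tmap (fun i : nat => i%:R / (2 * r%:R)) (iota 1 r.-1) in
  ret (0, cs).

(* t - a / 2, where a is the largest integer such that a / 2 < t. *)
Definition phase (R : realType) (t : R) : R :=
  t - (Num.ceil (t * 2) - 1)%:~R / 2.

Lemma phase_bounds (R : realType) (t : R) : 0 < phase t <= 1 / 2.
Proof.
rewrite /phase; have := ceil_itv (t * 2); rewrite !intrD rmorphN /=.
by move=> /andP[lo hi]; apply/andP; split; lra.
Qed.

Fixpoint midpoints (R : realType) (h : R) (hs : seq R) : timed (seq R) :=
  if hs is h' :: hs' then
    let! c := step ((h + h') / 2) in
    let! cs := midpoints h' hs' in
    ret (c :: cs)
  else ret [::].

Definition canonical_offsets (R : realType) (G : metric_graph R)
    (reqs : seq (request G)) : timed (R * seq R) :=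
  let! hs := tmap (fun q => phase (opening q)) reqs in
  let! sorted_hs := tsort hs in
  let! cs := if sorted_hs is h :: hs' then midpoints h hs' else ret [::] in
  ret (0, cs).

Definition offsets (R : realType) (G : metric_graph R)
    (reqs : seq (request G)) (s : R) : timed (R * seq R) :=
  let! den := find_den s 1 (size reqs).-1 in
  if den is Some r then uniform_offsets R r else canonical_offsets reqs.

Definition trim_and_repair (R : realType) (repair : repair_algorithm R)
    (G : metric_graph R) (reqs : seq (request G)) (s h : R) :
    timed (run G * R) :=
  let! treqs := tmap (trim h) reqs in
  repair G treqs s.

Fixpoint best_of (R : realType) (repair : repair_algorithm R)
    (G : metric_graph R) (reqs : seq (request G)) (s : R)
    (best : run G * R) (cs : seq R) : timed (run G) :=
  if cs is c :: cs' then
    let! cur := trim_and_repair repair reqs s c in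
    let! better := step (best.2 < cur.2) in
    best_of repair reqs s (if better then cur else best) cs'
  else ret best.1.

Definition speedup (R : realType) (repair : repair_algorithm R)
    (G : metric_graph R) (reqs : seq (request G)) (s : R) : timed (run G) :=
  let! cs := offsets reqs s in
  let! first := trim_and_repair repair reqs s cs.1 in
  best_of repair reqs s first cs.2.

(* Main.v *)
(** Retrace the route of R* at speed s along a zigzag: in units of a period,
    advance by s + 1, then go back by s - 1, once every two periods.  Every even
    period [j, j + 1) then covers the part [j - 1, j + s - 1) of the route and
    every odd one the part [j - 1, j + s - 2].  Together with the variants
    obtained by exchanging the parities and by reversing time, this gives four
    runs for each offset.  For s = q / r and the r uniform offsets, the trimmed
    windows of a request run through r equidistant positions, and each request
    served by R* is served by at least q of the 4r runs; hence the best of them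
    earns s/4 times the profit of R*.  When SPEEDUP uses the canonical offsets,
    apply this to rational approximations of s from below: the trimmed windows
    for any offset are those for some canonical offset up to a common shift. *)

Require Import Defs.
From HB Require Import structures.
From mathcomp Require Import all_boot all_order all_algebra.
From mathcomp Require Import boolp reals.
From mathcomp Require Import ring lra zify.

Set Implicit Arguments.
Unset Strict Implicit.
Unset Printing Implicit Defensive.

Import Order.TTheory GRing.Theory Num.Theory.
Local Open Scope ring_scope.

(** * Walks, distances, and changes of the speed or time of a run *)

Lemma walk_length_rcons (R : realType) (V : Type) (len : V -> V -> R) u p v :
  walk_length len u (rcons p v) = walk_length len u p + len (last u p) v.
Proof.
elim: p u => [|w p IH] u /=; first by rewrite addr0 add0r.
by rewrite IH addrA.
Qed.

Lemma reverse_walk (R : realType) (G : metric_graph R) (u : vertex G) p :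
  path (@adj R G) u p ->
  exists p', [/\ path (@adj R G) (last u p) p', last (last u p) p' = u
    & walk_length (@len R G) (last u p) p' = walk_length (@len R G) u p].
Proof.
elim: p u => [|v p IH] u /=; first by exists [::].
case/andP=> uv /IH[p' [p'_path p'_last p'_len]].
exists (rcons p' u); rewrite rcons_path p'_path p'_last last_rcons.
by rewrite adj_sym uv walk_length_rcons p'_last p'_len addrC (len_sym uv).
Qed.

Lemma dist_le_sym (R : realType) (G : metric_graph R) (p q : point G) d :
  dist_le p q d -> dist_le q p d.
Proof.
case=> [|[e [e' [w [ep e'q [w_path w_last] wd]]]]].
  case: p q => [?|u v x uv ?] [?|u' v' x' uv' ?] //= pq; left => /=.
  case: pq => -[eu ev xd]; subst; [left | right]; split=> //.
    by rewrite distrC.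
  have -> : x' - (len u' v' - x) = x - (len u' v' - x') by ring.
  by rewrite (len_sym uv').
have [w' [w'_path w'_last w'_len]] := reverse_walk w_path.
right; exists e', e, w'; rewrite -w_last; split=> //; rewrite w'_len.
by move: wd; lra.
Qed.

Lemma dist_le_trans_r (R : realType) (G : metric_graph R) (p q : point G) d d' :
  d <= d' -> dist_le p q d -> dist_le p q d'.
Proof.
move=> dd' [|[e [e' [w [ep e'q wl wd]]]]]; last first.
  by right; exists e, e', w; split=> //; apply: le_trans dd'.
case: p q => [?|u v x uv ?] [?|u' v' x' uv' ?] //= pq; left => /=.
by case: pq => -[? ? xd]; [left | right]; split=> //; apply: le_trans dd'.
Qed.

Lemma has_speed_le (R : realType) (G : metric_graph R) (rho : run G) s s' :
  s <= s' -> has_speed s rho -> has_speed s' rho.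
Proof.
move=> ss' [node0 lip]; split=> // t t' t0 tt'.
by apply: dist_le_trans_r (lip t t' t0 tt'); rewrite ler_wpM2r ?subr_ge0.
Qed.

Definition shift_run (R : realType) (G : metric_graph R) (d : R) (rho : run G) :
    run G :=
  Run (start rho + d) (fun t => pos rho (t - d)).

Lemma has_speed_shift (R : realType) (G : metric_graph R) (rho : run G) s d :
  has_speed s rho -> has_speed s (shift_run d rho).
Proof.
case=> [[v v_pos] lip]; split=> [|t t' t0 tt'] /=.
  by exists v; rewrite addrK.
have -> : t' - t = (t' - d) - (t - d) by rewrite opprB addrA subrK.
by apply: lip; rewrite ?lerD2r // lerBrDr.
Qed.

(* Before [start rho] the positions of [rho] are junk, so [phi] is clipped
   there; the bound on [phi t - t] makes the new run wait at the first node of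
   [rho] until [phi] reaches [start rho]. *)
Lemma retime_run (R : realType) (G : metric_graph R) (rho : run G) (s K : R)
    (phi : R -> R) :
  0 <= s -> has_speed 1 rho ->
  (forall t t', t <= t' -> `|phi t' - phi t| <= s * (t' - t)) ->
  (forall t, `|phi t - t| <= K) ->
  exists rho' : run G, has_speed s rho' /\
    forall t, start rho <= phi t ->
      start rho' <= t /\ pos rho' t = pos rho (phi t).
Proof.
move=> s_ge0 [[v v_pos] lip] phi_lip phi_near.
pose clip x := Num.max (start rho) x.
exists (Run (start rho - K) (fun t => pos rho (clip (phi t)))).
split=> [|t t_start] /=; last first.
  split; last by rewrite /clip max_r.
  by have := phi_near t; rewrite ler_norml => /andP[_]; lra.
split=> [|t t' /= _ tt'].
  exists v => /=; rewrite /clip max_l //.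
  by have := phi_near (start rho - K); rewrite ler_norml => /andP[_]; lra.
have clip_ge x : start rho <= clip x by rewrite /clip le_max lexx.
have clip_lip x y : `|clip x - clip y| <= `|x - y|.
  wlog yx : x y / y <= x => [wl|].
    by case/orP: (le_total y x) => /wl //; rewrite !(distrC y) !(distrC (clip y)).
  rewrite (ger0_norm (x := x - y)) ?subr_ge0 // /clip.
  case: (leP (start rho) x) => x0; case: (leP (start rho) y) => y0;
    rewrite ger0_norm; lra.
have pos_lip x y : start rho <= x -> start rho <= y ->
    dist_le (pos rho x) (pos rho y) `|y - x|.
  move=> x0 y0; case/orP: (le_total x y) => xy.
    by rewrite ger0_norm ?subr_ge0 // -[_ - _]mul1r; apply: lip.
  rewrite distrC ger0_norm ?subr_ge0 // -[_ - _]mul1r.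
  by apply/dist_le_sym/lip.
apply: dist_le_trans_r (pos_lip _ _ (clip_ge _) (clip_ge _)).
exact: le_trans (clip_lip _ _) (phi_lip _ _ tt').
Qed.

(** * The zigzag schedule and the parts of the route it covers *)

(* One cycle of the zigzag, of two periods: for [0 <= x <= 1], it rises with
   slope s from -1/2 at 0 to (s - 1)/2 at 1/2, falls to 0, and rises to 1/2. *)
Definition tooth (R : realType) (s x : R) : R :=
  Num.max ((s - 1) / 2 - s * `|x - 1 / 2|) (1 / 2 - s * (1 - x)).

(** Successive teeth, each advanced by 1, join continuously for [1 <= s] because [tooth] then rises
    by 1 over a cycle; on average the zigzag advances at unit speed. *)
Definition zigzag (R : realType) (s t : R) : R :=
  tooth s (t - (Num.floor t)%:~R) + (Num.floor t)%:~R.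

Lemma dist_max (R : realDomainType) (a b c d e : R) :
  `|a - c| <= e -> `|b - d| <= e -> `|Num.max a b - Num.max c d| <= e.
Proof.
rewrite !ler_norml => /andP[? ?] /andP[? ?].
by case: (leP a b) => ?; case: (leP c d) => ?; apply/andP; split; lra.
Qed.

(** Both branches of the maximum are s-Lipschitz. *)
Lemma tooth_lip (R : realType) (s x y : R) :
  0 <= s -> x <= y -> `|tooth s y - tooth s x| <= s * (y - x).
Proof.
move=> s0 xy; have xy0 : 0 <= y - x by rewrite subr_ge0.
apply: dist_max.
  have -> : (s - 1) / 2 - s * `|y - 1 / 2| - ((s - 1) / 2 - s * `|x - 1 / 2|)
      = s * (`|x - 1 / 2| - `|y - 1 / 2|) by ring.
  rewrite normrM ger0_norm // ler_wpM2l // distrC.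
  by apply: le_trans (ler_dist_dist _ _) _; rewrite opprB addrA subrK ger0_norm.
have -> : 1 / 2 - s * (1 - y) - (1 / 2 - s * (1 - x)) = s * (y - x) by ring.
by rewrite ger0_norm ?mulr_ge0.
Qed.

Lemma tooth0 (R : realType) (s : R) : 1 <= s -> tooth s 0 = - (1 / 2).
Proof.
by move=> s1; rewrite /tooth sub0r normrN ger0_norm ?max_l; lra.
Qed.

Lemma tooth1 (R : realType) (s : R) : 1 <= s -> tooth s 1 = 1 / 2.
Proof.
move=> s1; rewrite /tooth subrr mulr0 (_ : 1 - 1 / 2 = 1 / 2); last by lra.
by rewrite ger0_norm ?max_r; lra.
Qed.

Lemma zigzag_lip (R : realType) (s t t' : R) :
  1 <= s -> t <= t' -> `|zigzag s t' - zigzag s t| <= s * (t' - t).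
Proof.
move=> s1 tt'; have s0 : 0 <= s by lra.
have /andP[] := floor_itv t; have /andP[] := floor_itv t'.
have := le_floor tt'; rewrite /zigzag !intrD.
move: (Num.floor t) (Num.floor t') => n n' nn' lo' hi' lo hi.
case: (eqVneq n n') => [<- | n_neq].
  rewrite opprD addrACA subrr addr0.
  have -> : t' - t = (t' - n%:~R) - (t - n%:~R) by ring.
  by apply: tooth_lip => //; rewrite lerD2r.
(* In different cycles: the zigzag is at [n + 1/2] at the end of the first and at [n' - 1/2] at the
   start of the last; in between it advances at average speed 1, which is at most s. *)
have {n_neq}nn' : n + 1 <= n' by rewrite lezD1 lt_neqAle n_neq.
have {}nn' : (n%:~R + 1 : R) <= n'%:~R by rewrite -(ler_int R) intrD in nn'.
have x'0 : 0 <= t' - n'%:~R by lra.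
have x1 : t - n%:~R <= 1 by lra.
have := tooth_lip s0 x'0; rewrite tooth0 //.
have := tooth_lip s0 x1; rewrite tooth1 //.
have gap0 : 0 <= n'%:~R - n%:~R - 1 :> R by lra.
have := ler_wpM2r gap0 s1; rewrite mul1r.
move: (tooth s _) (tooth s _) => a b.
by rewrite !ler_norml => ? /andP[? ?] /andP[? ?]; lra.
Qed.

Lemma zigzag_near (R : realType) (s t : R) :
  1 <= s -> `|zigzag s t - t| <= s + 2.
Proof.
move=> s1; rewrite /zigzag; have /andP[] := floor_itv t.
rewrite intrD; move: (Num.floor t) => n lo hi.
have x0 : 0 <= t - n%:~R by lra.
have := tooth_lip (le_trans ler01 s1) x0; rewrite tooth0 // subr0.
have : s * (t - n%:~R) <= s * 1 by rewrite ler_wpM2l; lra.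
by move: (tooth _ _) => a; rewrite !ler_norml => ? /andP[? ?]; lra.
Qed.

Lemma zigzag_int (R : realType) (s x : R) (n : int) :
  0 <= x < 1 -> zigzag s (n%:~R + x) = n%:~R + tooth s x.
Proof.
move=> x01; rewrite /zigzag (@floor_def _ _ n); last by rewrite intrD; lra.
by rewrite addrC; congr (_ + tooth s _); ring.
Qed.

Definition oddz (j : int) : bool := (j %% 2)%Z == 1.

(* How far, relative to the start of period j, the zigzag gets during it. *)
Definition reach (R : realType) (s : R) (j : int) : R :=
  if oddz j then s / 2 - 1 else s / 2 - 1 / 2.

Lemma zigzag_covers (R : realType) (s y : R) (j : int) :
  1 < s -> - (1 / 2) < y < reach s j ->
  exists x, j%:~R / 2 < x < (j%:~R + 1) / 2 /\ zigzag s x = j%:~R / 2 + y.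
Proof.
move=> s1 /andP[lo hi]; have s0 : 0 < s by lra.
have [n jE] : exists n : int, j = n * 2 + (oddz j)%:Z.
  by exists (j %/ 2)%Z; rewrite /oddz; lia.
have jR : (j%:~R : R) = n%:~R * 2 + (oddz j)%:R by rewrite [in LHS]jE intrD intrM.
move: hi; rewrite jR /reach; case: (oddz j) => /= hi.
  (* In an odd period the target is met on the falling branch; z solves the linear equation. *)
  pose z := (s / 2 - 1 - y) / s.
  have sz : s * z = s / 2 - 1 - y by rewrite mulrC divfK ?gt_eqF.
  have z0 : 0 < z by rewrite divr_gt0; lra.
  have z1 : z < 1 / 2 by rewrite ltr_pdivrMr //; lra.
  exists (n%:~R + (1 / 2 + z)); split; first by lra.
  rewrite zigzag_int; last by lra.
  by rewrite /tooth ger0_norm ?max_l; lra.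
(* In an even period the target is met on the first rising branch. *)
pose z := (y + 1 / 2) / s.
have sz : s * z = y + 1 / 2 by rewrite mulrC divfK ?gt_eqF.
have z0 : 0 < z by rewrite divr_gt0; lra.
have z1 : z < 1 / 2 by rewrite ltr_pdivrMr //; lra.
exists (n%:~R + z); split; first by lra.
rewrite zigzag_int; last by lra.
by rewrite /tooth ler0_norm ?max_l; lra.
Qed.

(** The time on the route of R* that is copied at time t. [mirror] conjugates with the reflection in
    o, hence the opposite sign of [delta]; [shifted] moves the zigzag by one period, which exchanges
    the parities. *)
Definition schedule (R : realType) (s h delta : R) (mirror shifted : bool)
    (t : R) : R :=
  let o := h + shifted%:R / 2 in
  if mirror then - zigzag s (- (t - o)) + o - delta
  else zigzag s (t - o) + o + delta.

Lemma schedule_lip (R : realType) (s h delta : R) b e (t t' : R) :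
  1 <= s -> t <= t' ->
  `|schedule s h delta b e t' - schedule s h delta b e t| <= s * (t' - t).
Proof.
move=> s1 tt'; rewrite /schedule; set o := h + _; case: b.
  have tt'o : - (t' - o) <= - (t - o) by lra.
  have := zigzag_lip s1 tt'o; move: (zigzag _ _) (zigzag _ _) => a c.
  by rewrite !ler_norml => /andP[? ?]; lra.
have tt'o : t - o <= t' - o by lra.
have := zigzag_lip s1 tt'o; move: (zigzag _ _) (zigzag _ _) => a c.
by rewrite !ler_norml => /andP[? ?]; lra.
Qed.

Lemma schedule_near (R : realType) (s h delta : R) b e (t : R) :
  1 <= s -> 0 <= delta -> `|schedule s h delta b e t - t| <= s + 2 + delta.
Proof.
move=> s1 d0; rewrite /schedule; set o := h + _.
have := zigzag_near (- (t - o)) s1; have := zigzag_near (t - o) s1.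
move: (zigzag _ _) (zigzag _ _) => a c.
by rewrite !ler_norml => /andP[? ?] /andP[? ?]; case: b; lra.
Qed.

Lemma boundaryS (R : realType) (h : R) (j : int) :
  boundary h (j + 1) = boundary h j + 1 / 2.
Proof. by rewrite /boundary intrD; lra. Qed.

Lemma reach_opp (R : realType) (s : R) (j : int) : reach s (- j) = reach s j.
Proof. by rewrite /reach (_ : oddz (- j) = oddz j) // /oddz; lia. Qed.

(* Time reversal sends the period j to the period - j - 1 and the time y after
   the start of the former to the time 1/2 - y after the start of the latter. *)
Lemma schedule_covers (R : realType) (s h delta y : R) (b e : bool) (j : int) :
  1 < s ->
  - (1 / 2) < (if b then 1 / 2 - y else y) - delta <
    reach s (if b then j + 1 - e%:Z else j - e%:Z) ->
  exists x, boundary h j <= x < boundary h (j + 1) /\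
    schedule s h delta b e x = boundary h j + y.
Proof.
move=> s1; rewrite boundaryS /schedule /boundary; case: b => cov.
  (* After reflection, the zigzag is used in its period [e - j - 1], which has the parity of
     [j + 1 - e]. *)
  rewrite -reach_opp in cov.
  have [x []] := zigzag_covers s1 cov; rewrite !(intrD, rmorphN) /= => xj zx.
  exists (h + e%:R / 2 - x); split.
    by move: xj; case: (e) => /=; lra.
  have -> : - (h + e%:R / 2 - x - (h + e%:R / 2)) = x by ring.
  by rewrite zx; case: (e) => /=; lra.
have [x []] := zigzag_covers s1 cov; rewrite !(intrD, rmorphN) /= => xj zx.
exists (h + e%:R / 2 + x); split.
  by move: xj; case: (e) => /=; lra.
have -> : h + e%:R / 2 + x - (h + e%:R / 2) = x by ring.
by rewrite zx; case: (e) => /=; lra.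
Qed.

(** * Counting the runs that serve one request *)

(** The count is [r - 1 - a] clipped to [[0, r]]; the disjunction is its lower bound in a form
    suited to linear arithmetic. *)
Lemma count_gt (r : nat) (a : int) (c := (\sum_(i < r) (a < i%:Z)%R)%N) :
  r%:Z - 1 - a <= c%:Z \/ (r <= c)%N.
Proof.
rewrite /c {c}; elim: r => [|r IH]; first by right.
by rewrite big_ord_recr /=; move: (\sum_(i < r) _)%N IH => c; lia.
Qed.

Lemma count_le (r : nat) (a : int) (c := (\sum_(i < r) (i%:Z <= a)%R)%N) :
  a + 1 <= c%:Z \/ (r <= c)%N.
Proof.
rewrite /c {c}; elim: r => [|r IH]; first by right.
by rewrite big_ord_recr /=; move: (\sum_(i < r) _)%N IH => c; lia.
Qed.

(** The first two counts add up to at least [min(2r, q - 1 - d)], the last two to at least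
    [min(2r, d + q - 2r + 1)]. The four ways to resolve the minima give [4r], [q + d + 1],
    [q + 2r - 1 - d] and [2q - 2r], each at least q by one of the four bounds on q and d. *)
Lemma count_services (q r : nat) (d : int) :
  (2 * r <= q <= 4 * r)%N -> -1 <= d <= 2 * r%:Z - 1 ->
  (q <= \sum_(i < r) ((d - q%:Z + r%:Z < i%:Z)%R + (d - q%:Z + 2 * r%:Z < i%:Z)%R
     + (i%:Z <= d + q%:Z - 2 * r%:Z)%R + (i%:Z <= d + q%:Z - 3 * r%:Z)%R))%N.
Proof.
move=> qr dr; rewrite !big_split /=.
have := count_gt r (d - q%:Z + r%:Z); have := count_gt r (d - q%:Z + 2 * r%:Z).
have := count_le r (d + q%:Z - 2 * r%:Z); have := count_le r (d + q%:Z - 3 * r%:Z).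
move: (\sum_(i < r) _)%N (\sum_(i < r) _)%N (\sum_(i < r) _)%N => c1 c2 c3.
by move: (\sum_(i < r) _)%N => c4; lia.
Qed.

Definition uniform_offset (R : realType) (r k : nat) : R := k%:R / (2 * r%:R).

(* Whether one of the runs serves, in period j, a request that R* serves at time
   y after the start of that period. *)
Definition reaches (R : realType) (s y : R) (j : int) (b e : bool) : bool :=
  (if b then 1 / 2 - y else y) <= reach s (if b then j + 1 - e%:Z else j - e%:Z).

(** For each b, the two values of e meet one even and one odd period, so the parity of j cancels
    from the sum. *)
Lemma sum_reaches (R : realType) (s y : R) (j : int) :
  (\sum_(b : bool) \sum_(e : bool) reaches s y j b e =
   (y <= s / 2 - 1 / 2)%R + (y <= s / 2 - 1)%R + (1 - s / 2 <= y)%R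
   + (3 / 2 - s / 2 <= y)%R)%N.
Proof.
rewrite !big_bool /= /reaches /reach /= !subr0 addrK.
have -> : oddz (j + 1) = ~~ oddz j by rewrite /oddz; lia.
have -> : oddz (j - 1) = ~~ oddz j by rewrite /oddz; lia.
have e1 : (1 / 2 - y <= s / 2 - 1) = (3 / 2 - s / 2 <= y) by apply/idP/idP; lra.
have e2 : (1 / 2 - y <= s / 2 - 1 / 2) = (1 - s / 2 <= y) by apply/idP/idP; lra.
by case: (oddz j) => /=; rewrite e1 e2;
  move: (y <= _) (y <= _) (_ <= y) (_ <= y); lia.
Qed.

Lemma two_mul_offset (R : realType) (r k : nat) : (0 < r)%N ->
  2 * r%:R * uniform_offset R r k = k%:R.
Proof.
by move=> r0; rewrite /uniform_offset mulrC divfK // mulf_neq0 // pnatr_eq0 -lt0n.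
Qed.

(* In units of 1 / (2r), the periods that the r offsets assign to a window are
   shifted by all the residues modulo r. *)
Lemma period_shift (R : realType) (r k : nat) (w : R) :
  (0 < r)%N -> (k < r)%N ->
  0 <= k%:Z + r%:Z * period_index (uniform_offset R r k) w
       - Num.ceil (2 * r%:R * w) < r%:Z.
Proof.
move=> r0 kr; set j := period_index _ _; have rR : 0 < r%:R :> R by rewrite ltr0n.
have := ceil_itv ((w - uniform_offset R r k) * 2).
rewrite -/(period_index _ _) -/j intrD => /andP[lo hi].
have offk := two_mul_offset R k r0.
have /(ler_wpM2l (ltW rR)) := hi; move: lo; rewrite -(ltr_pM2l rR).
have -> : r%:R * ((w - uniform_offset R r k) * 2) = 2 * r%:R * w - k%:R.
  by rewrite -offk; ring.
move=> lo {}hi; apply/andP; split.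
  rewrite subr_ge0 ceil_le_int intrD intrM /= -!pmulrn.
  by lra.
have := ceil_itv (2 * r%:R * w); rewrite -(ltr_int R) !(intrD, intrM, rmorphN) /=.
rewrite -!pmulrn => /andP[_]; lra.
Qed.

(** The shifts lie in [[0, r)] and are congruent to k plus a constant modulo r, so k is sent to its
    shift by a permutation of ['I_r]. *)
Lemma sum_period_shift (R : realType) (r : nat) (w : R) (F : int -> nat) :
  (0 < r)%N ->
  (\sum_(k < r) F (k%:Z + r%:Z * period_index (uniform_offset R r k) w
                   - Num.ceil (2 * r%:R * w))%R = \sum_(i < r) F i%:Z)%N.
Proof.
move=> r0.
pose shift (k : 'I_r) : int := k%:Z
  + r%:Z * period_index (uniform_offset R r k) w - Num.ceil (2 * r%:R * w).
have shiftP k : 0 <= shift k < r%:Z by apply: period_shift.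
have lt_r k : (`|shift k| < r)%N by have := shiftP k; lia.
pose g k := Ordinal (lt_r k).
have gE k : (g k)%:Z = shift k.
  by rewrite /g /=; have := shiftP k; lia.
rewrite [RHS](reindex_inj (h := g)); first by apply: eq_bigr => k _; rewrite gE.
move=> k k' /(congr1 (fun i : 'I_r => i%:Z)); rewrite !gE /shift.
move/addIr/(congr1 (fun z => z %% r%:Z)%Z).
rewrite !(addrC (_ : 'I_r)%:Z) ![r%:Z * _]mulrC !modzMDl.
by rewrite !modz_small => [[/val_inj]| |]; rewrite //= ltz_nat.
Qed.

Lemma served_count (R : realType) (q r : nat) (s w t : R) :
  (0 < r)%N -> (2 * r <= q <= 4 * r)%N -> s * r%:R = q%:R -> w <= t < w + 1 ->
  (q <= \sum_(k < r) \sum_(b : bool) \sum_(e : bool)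
     let h := uniform_offset R r k in
     let j := period_index h w in reaches s (t - boundary h j) j b e)%N.
Proof.
move=> r0 qr sr /andP[wt tw]; have rR : 0 < r%:R :> R by rewrite ltr0n.
(* The delay of the service after the opening of the window, in units of [1 / (2r)]; it is -1 when
   both times lie strictly between two consecutive multiples of the unit. *)
set d := Num.floor (2 * r%:R * t) - Num.ceil (2 * r%:R * w).
have /andP[T1 T2] := floor_itv (2 * r%:R * t).
have /andP[W1 W2] := ceil_itv (2 * r%:R * w).
have dP : -1 <= d <= 2 * r%:Z - 1.
  have := ler_wpM2l (ltW rR) wt; have := tw; rewrite -(ltr_pM2l rR) => rtw rwt.
  rewrite !intrD in T2 W1; rewrite /d.
  have : (-2)%:~R < (d%:~R : R) by rewrite /d intrD rmorphN /=; lra.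
  have : d%:~R < (2 * r%:Z)%:~R :> R.
    by rewrite /d intrM intrD rmorphN /= -pmulrn; lra.
  by rewrite !ltr_int /d; lia.
(* The four conditions of [sum_reaches], rounded to integers and expressed by the shift i of the
   period. *)
pose F (i : int) : nat := ((d - q%:Z + r%:Z < i)%R + (d - q%:Z + 2 * r%:Z < i)%R
  + (i <= d + q%:Z - 2 * r%:Z)%R + (i <= d + q%:Z - 3 * r%:Z)%R)%N.
apply: (@leq_trans (\sum_(i < r) F i%:Z)); first exact: count_services.
rewrite -(sum_period_shift w F r0); apply: leq_sum => k _.
rewrite /= sum_reaches; set h := uniform_offset _ _ _; set j := period_index _ _.
set y := t - _; have ry : 2 * r%:R * y = 2 * r%:R * t - k%:R - r%:R * j%:~R.
  by rewrite /y /boundary -(two_mul_offset R k r0) -/h; field.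
(* Comparing y with a multiple of [1 / (2r)] reduces to comparing integers with the floor of
   [2 * r * t]. *)
have le_y (z : R) (a : int) : 2 * r%:R * z = a%:~R ->
    (Num.floor (2 * r%:R * t) < a + k%:Z + r%:Z * j -> y <= z) /\
    (a + k%:Z + r%:Z * j <= Num.floor (2 * r%:R * t) -> z <= y).
  move=> za; have r2 : 0 < 2 * r%:R :> R by lra.
  rewrite -(ler_pM2l r2) -[z <= y](ler_pM2l r2) za ry -lezD1 -!(ler_int R).
  rewrite !intrD in T2 *; rewrite !intrM -!pmulrn; split; lra.
have imp (a b : bool) : (a -> b) -> (a <= b)%N by case: a; case: b => // /(_ isT).
apply: leq_add; [apply: leq_add; [apply: leq_add|]|]; apply: imp => c.
- apply: (le_y _ (q%:Z - r%:Z) _).1; last by rewrite /d in c; lia.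
  by rewrite intrD rmorphN /= -!pmulrn -sr; field.
- apply: (le_y _ (q%:Z - 2 * r%:Z) _).1; last by rewrite /d in c; lia.
  by rewrite !(intrD, intrM, rmorphN) /= -!pmulrn -sr; field.
- apply: (le_y _ (2 * r%:Z - q%:Z) _).2; last by rewrite /d in c; lia.
  by rewrite !(intrD, intrM, rmorphN) /= -!pmulrn -sr; field.
- apply: (le_y _ (3 * r%:Z - q%:Z) _).2; last by rewrite /d in c; lia.
  by rewrite !(intrD, intrM, rmorphN) /= -!pmulrn -sr; field.
Qed.

(** * Averaging over the 4r runs *)

Lemma exists_ge_average (R : realFieldType) (I : finType) (f : I -> R) (c : R) :
  (0 < #|I|)%N -> #|I|%:R * c <= \sum_i f i -> exists i, c <= f i.
Proof.
move=> /card_gt0P[i0 _] cf; apply: contrapT => /forallNP no.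
have : \sum_i f i < \sum_(i : I) c.
  apply: ltr_sum; first by apply/hasP; exists i0; rewrite ?mem_index_enum.
  by move=> i _; rewrite ltNge; apply/negP/no.
by rewrite sumr_const -mulr_natl ltNge cf.
Qed.

Lemma common_margin (R : realFieldType) (I : finType) (f : I -> R) :
  (forall i, 0 < f i) -> exists2 d, 0 < d & forall i, d < f i.
Proof.
(* The seed 1 of the minimum covers an empty I; halving makes the bound strict. *)
move=> f0; have min0 : 0 < \big[Order.min/1]_i f i by apply: lt_bigmin.
exists (\big[Order.min/1]_i f i / 2) => [|i]; first by lra.
by have := bigmin_le 1 i f; lra.
Qed.

Lemma profit_mapE (R : realType) (G : metric_graph R) (reqs : seq (request G))
    (f : request G -> request G) (rho : run G) :
  profit [seq f p | p <- reqs] rho =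
  \sum_(i < size reqs) if `[< serviced rho (f (tnth (in_tuple reqs) i)) >]
    then gain (f (tnth (in_tuple reqs) i)) else 0.
Proof. by rewrite /profit big_map big_tnth. Qed.

Lemma unit_windowsP (R : realType) (G : metric_graph R) (reqs : seq (request G)) i :
  unit_windows reqs -> let p := tnth (in_tuple reqs) i in
  0 <= gain p /\ closing p = opening p + 1.
Proof.
rewrite /unit_windows -[reqs in all _ reqs]/(tval (in_tuple reqs)).
by move/all_tnthP/(_ i)/andP=> [? /eqP].
Qed.

(* The delay [delta] turns the open conditions of [schedule_covers] into the
   closed ones of [reaches]. *)
Lemma exists_uniform_offset (R : realType) (G : metric_graph R)
    (reqs : seq (request G)) (rho : run G) (q r : nat) (s : R) :
  (0 < r)%N -> (2 * r <= q <= 4 * r)%N -> s * r%:R = q%:R ->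
  unit_windows reqs -> has_speed 1 rho ->
  exists (k : 'I_r) (rho' : run G), has_speed s rho' /\
    s / 4 * profit reqs rho <=
      profit [seq trim (uniform_offset R r k) p | p <- reqs] rho'.
Proof.
move=> r0 qr sr unit_w speed1; have rR : 0 < r%:R :> R by rewrite ltr0n.
have s2 : 2 <= s.
  by rewrite -(ler_pM2r rR) sr -natrM ler_nat; case/andP: qr.
pose p i := tnth (in_tuple reqs) i.
pose off (k : 'I_r) := uniform_offset R r k.
pose j i k := period_index (off k) (opening (p i)).
(* A service time for each request that [rho] serves; 0 is a dummy value for the others. *)
have /choice[t tP] : forall i, exists t, serviced rho (p i) ->
    [/\ start rho <= t, opening (p i) <= t < closing (p i)
      & pos rho t = AtNode (node (p i))].
  move=> i; have [[t ?]|no] := pselect (serviced rho (p i)); first by exists t.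
  by exists 0.
pose y i k := t i - boundary (off k) (j i k).
(* The margins in [- (1 / 2) < y] and in its mirror image [- (1 / 2) < 1 / 2 - y]; both are positive
   since a window opens less than a period before its trimmed part and lasts two periods. The value
   1 is a dummy. *)
pose slack (x : 'I_(size reqs) * 'I_r) : R :=
  if `[< serviced rho (p x.1) >] then Num.min (y x.1 x.2 + 1 / 2) (1 - y x.1 x.2)
  else 1.
have /common_margin[delta d0 dP] : forall x, 0 < slack x.
  move=> [i k]; rewrite /slack /=; case: asboolP => // /tP[_ ti _].
  have [_ pi] := unit_windowsP i unit_w; rewrite -/(p i) pi in ti.
  have := ceil_itv ((opening (p i) - off k) * 2); rewrite -/(period_index _ _).
  rewrite -/(j i k) intrD rmorphN /= /y /boundary => jP.
  by rewrite lt_min; apply/andP; split; lra.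
have /choice[run_of run_ofP] : forall x : 'I_r * (bool * bool),
    exists rho' : run G, has_speed s rho' /\
    forall x0, start rho <= schedule s (off x.1) delta x.2.1 x.2.2 x0 ->
      start rho' <= x0 /\
      pos rho' x0 = pos rho (schedule s (off x.1) delta x.2.1 x.2.2 x0).
  move=> x; apply: (@retime_run _ _ _ _ (s + 2 + delta)) => //.
  - by lra.
  - by move=> *; apply: schedule_lip => //; lra.
  - by move=> *; apply: schedule_near; lra.
have service i k b e : serviced rho (p i) -> reaches s (y i k) (j i k) b e ->
    serviced (run_of (k, (b, e))) (trim (off k) (p i)).
  move=> served; have [t_start _ t_pos] := tP i served.
  have := dP (i, k); rewrite /slack asboolT //= lt_min => /andP[dlo dhi].
  rewrite /reaches => ys.
  have cov : - (1 / 2) < (if b then 1 / 2 - y i k else y i k) - delta <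
      reach s (if b then j i k + 1 - e%:Z else j i k - e%:Z).
    by apply/andP; split; [case: (b); lra | lra].
  have [|x [xj xt]] := schedule_covers (off k) _ cov; first by lra.
  have [_ /(_ x)] := run_ofP (k, (b, e)); rewrite /= xt /y addrC subrK.
  by case/(_ t_start) => ? ?; exists x; rewrite /trim /= -/(j i k) -t_pos.
have [x le_x] : exists x, s / 4 * profit reqs rho <=
    profit [seq trim (off x.1) p | p <- reqs] (run_of x).
  apply: exists_ge_average.
    by apply/card_gt0P; exists (Ordinal r0, (true, true)).
  rewrite !card_prod card_ord card_bool natrM.
  (* As [s * r = q], it suffices that the profits of the 4r runs add up to q times that of [rho];
     this is checked request by request. *)
  have -> : r%:R * (2 * 2)%:R * (s / 4 * profit reqs rho) =
      q%:R * profit reqs rho by rewrite -sr natrM; field.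
  under eq_bigr do rewrite profit_mapE.
  rewrite exchange_big /= [profit _ _]big_tnth mulr_sumr.
  apply: ler_sum => i _; rewrite -/(p i).
  have [gain0 pi] := unit_windowsP i unit_w; rewrite -/(p i) in gain0 pi.
  case: asboolP => [served | _]; last first.
    by rewrite mulr0; apply: sumr_ge0 => x _; case: ifP.
  have [_ ti _] := tP i served; rewrite pi in ti.
  have := served_count r0 qr sr ti.
  rewrite (eq_bigr (fun k : 'I_r => \sum_(be : bool * bool)
    (reaches s (y i k) (j i k) be.1 be.2 : nat))%N); last first.
    by move=> k _; rewrite pair_bigA.
  rewrite pair_bigA /= -(ler_nat R) natr_sum => count.
  apply: le_trans (ler_wpM2r gain0 count) _; rewrite mulr_suml.
  apply: ler_sum => -[k [b e]] _ /=.
  case rb : (reaches _ _ _ _ _); last by rewrite mul0r; case: ifP.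
  by rewrite mul1r asboolT //; apply: service.
by exists x.1, (run_of x); split=> //; have [] := run_ofP x.
Qed.

(** * Trimmed windows and their dependence on the offset *)

Lemma profit_trim_le (R : realType) (G : metric_graph R) (reqs : seq (request G))
    (h : R) (rho : run G) :
  unit_windows reqs ->
  profit [seq trim h p | p <- reqs] rho <= profit reqs rho.
Proof.
move=> unit_w; rewrite -[in leRHS](map_id reqs) !profit_mapE.
apply: ler_sum => i _; have [gain0 pE] := unit_windowsP i unit_w.
case: asboolP => [[t [t0 t_in t_pos]] | _]; last by case: ifP.
rewrite asboolT //; exists t; split=> //=.
move: t_in => /= /andP[lo hi].
have [lo' hi'] := period_index_sub h (opening (tnth (in_tuple reqs) i)).
by rewrite pE (le_trans lo' lo) (lt_le_trans hi hi').
Qed.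

Lemma trimmed_trim (R : realType) (G : metric_graph R) (reqs : seq (request G))
    (h : R) :
  unit_windows reqs -> trimmed [seq trim h p | p <- reqs].
Proof.
move=> unit_w; exists h; rewrite all_map.
apply: sub_all unit_w => p /= /andP[-> _] /=.
rewrite boundaryS eqxx andbT /boundary addrC addKr divfK ?intr_int //.
by rewrite pnatr_eq0.
Qed.

(** Apart from the summand h, the trimmed window depends on h only through the comparison with the
    phase. Offsets that split the phases alike thus give the same trimming up to a common shift. *)
Lemma boundary_period_index (R : realType) (h w : R) :
  0 <= h < 1 / 2 ->
  boundary h (period_index h w) =
  h + (Num.ceil (w * 2))%:~R / 2 - (if phase w <= h then 1 / 2 else 0).
Proof.
move=> hP; have := phase_bounds w; rewrite /phase; set C := Num.ceil _.
rewrite intrD rmorphN /= => phP; rewrite /boundary /period_index.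
case: leP => wh.
  rewrite (@ceil_def _ _ (C - 1)) intrD rmorphN /=; first by lra.
  by rewrite intrD rmorphN /=; lra.
by rewrite (@ceil_def _ _ C) ?intrD ?rmorphN /=; lra.
Qed.

(** Runs are unrooted in time, so a common shift of the trimmed windows is compensated by moving the
    run. *)
Lemma profit_trim_shift (R : realType) (G : metric_graph R)
    (reqs : seq (request G)) (s h c d : R) (rho : run G) :
  unit_windows reqs -> has_speed s rho ->
  all (fun p => boundary h (period_index h (opening p)) ==
    boundary c (period_index c (opening p)) + d) reqs ->
  exists rho', has_speed s rho' /\
    profit [seq trim h p | p <- reqs] rho <=
    profit [seq trim c p | p <- reqs] rho'.
Proof.
move=> unit_w speed_s eq_d; exists (shift_run (- d) rho).
split; first exact: has_speed_shift.
rewrite !profit_mapE; apply: ler_sum => i _ /=.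
have [gain0 _] := unit_windowsP i unit_w.
rewrite -[reqs in all _ reqs]/(tval (in_tuple reqs)) in eq_d.
have /all_tnthP/(_ i)/eqP hc := eq_d.
case: asboolP => [[t /= [t0 t_in t_pos]] | _]; last by case: ifP.
rewrite asboolT //; exists (t - d); split=> /=; first by rewrite lerD2r.
  by move: t_in; rewrite !boundaryS hc; lra.
by rewrite opprK subrK.
Qed.

(** * Sorting and the canonical offsets *)

Lemma tmapE (A B : Type) (f : A -> B) s : tmap f s = (map f s, size s).
Proof. by elim: s => //= a s ->; rewrite /bind /= addn0. Qed.

Lemma perm_tinsert (R : realType) (x : R) s :
  perm_eq (tinsert x s).1 (x :: s).
Proof.
elim: s => //= y s IH; rewrite /bind /=; case: ifP => //= _.
apply: perm_trans (_ : perm_eq _ (y :: x :: s)) _; first by rewrite perm_cons.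
by rewrite -cat1s -[x :: s]cat1s perm_catCA.
Qed.

Lemma path_tinsert (R : realType) (a x : R) s :
  a <= x -> path <=%R a s -> path <=%R a (tinsert x s).1.
Proof.
elim: s a => [|y s IH] a ax /=; first by rewrite ax.
case/andP=> ay ys; rewrite /bind /=; case: leP => [xy | /ltW yx] /=.
  by rewrite ax xy.
by rewrite ay IH.
Qed.

Lemma sorted_tinsert (R : realType) (x : R) s :
  sorted <=%R s -> sorted <=%R (tinsert x s).1.
Proof.
case: s => //= y s ys; rewrite /bind /=; case: leP => [xy | /ltW yx] /=.
  by rewrite xy.
exact: path_tinsert.
Qed.

Lemma tinsert_time (R : realType) (x : R) s : ((tinsert x s).2 <= size s + 1)%N.
Proof.
elim: s => //= y s; rewrite /bind /=; case: ifP => _ /= IH; first by rewrite addn1.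
by rewrite addn0 add1n addn1 ltnS -addn1.
Qed.

Lemma tsort_correct (R : realType) (s : seq R) :
  perm_eq (tsort s).1 s /\ sorted <=%R (tsort s).1.
Proof.
elim: s => //= x s [perm_s sorted_s]; split; last exact: sorted_tinsert.
by apply: perm_trans (perm_tinsert _ _) _; rewrite perm_cons.
Qed.

Lemma tsort_time (R : realType) (s : seq R) :
  ((tsort s).2 <= size s * size s)%N.
Proof.
elim: s => //= x s IH; have := tinsert_time x (tsort s).1.
rewrite (perm_size (tsort_correct s).1) /bind /=.
by move: (tinsert _ _).2 (tsort _).2 (size s) IH; nia.
Qed.

Lemma midpoints_size (R : realType) (h : R) hs :
  size (midpoints h hs).1 = size hs /\ (midpoints h hs).2 = size hs.
Proof.
by elim: hs h => //= h' hs IH h; have [-> ->] := IH h'; rewrite addn0.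
Qed.

Lemma midpoints_separate (R : realType) (x h0 : R) hs :
  path <=%R h0 hs -> h0 <= x -> has (fun h => x < h) hs ->
  exists c, [/\ c \in (midpoints h0 hs).1, h0 <= c, has (fun h => c < h) hs
    & all (fun h => (h <= x) == (h <= c)) (h0 :: hs)].
Proof.
elim: hs h0 => //= h1 hs IH h0 /andP[h01 h1_path] h0x.
case: (leP h1 x) => [h1x /= x_hs | xh1 _] /=.
  have [c [c_mid h1c c_hs c_all]] := IH h1 h1_path h1x x_hs.
  exists c; rewrite inE c_mid orbT c_hs orbT (le_trans h01 h1c).
  by move: c_all => /= /andP[/eqP <- ->]; rewrite h0x h1x.
exists ((h0 + h1) / 2); split; rewrite ?inE ?eqxx //; first by lra.
  by apply/orP; left; lra.
rewrite h0x (_ : h0 <= (h0 + h1) / 2) /=; last by lra.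
have mid_h1 : (h0 + h1) / 2 < h1 by lra.
rewrite leNgt mid_h1 /=; apply: sub_all (order_path_min le_trans h1_path) => h h1h.
by rewrite !leNgt (lt_le_trans xh1 h1h) (lt_le_trans mid_h1 h1h).
Qed.

Definition offset_list (R : realType) (cs : timed (R * seq R)) : seq R :=
  cs.1.1 :: cs.1.2.

(* The trimmed windows for h = 0 are also, up to a common shift, those for an h
   above all phases. *)
Lemma canonical_offsets_cover (R : realType) (G : metric_graph R)
    (reqs : seq (request G)) (h : R) :
  0 <= h < 1 / 2 ->
  exists2 c, c \in offset_list (canonical_offsets reqs) & exists d,
    all (fun p => boundary h (period_index h (opening p)) ==
      boundary c (period_index c (opening p)) + d) reqs.
Proof.
move=> hP; have zeroP : 0 <= (0 : R) < 1 / 2 by lra.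
have phase0 (w : R) : (phase w <= 0) = false.
  by apply/negbTE; have := phase_bounds w; rewrite -ltNge; lra.
rewrite /canonical_offsets tmapE /offset_list /=.
set ph := map _ reqs; have [ph_perm ph_sorted] := tsort_correct ph.
have [below | /allPn[b b_ph]] := boolP (all (fun x => x <= h) ph).
  exists 0; first by rewrite inE eqxx.
  exists (h - 1 / 2); move: below; rewrite /ph all_map; apply: sub_all => p /= ph_h.
  by rewrite !boundary_period_index // phase0 ph_h; apply/eqP; lra.
rewrite -ltNge => hb.
(* If all phases exceed h, then h and 0 split them alike. *)
have [above | /allPn[a a_ph]] := boolP (all (fun x => h < x) ph).
  exists 0; first by rewrite inE eqxx.
  exists h; move: above; rewrite /ph all_map; apply: sub_all => p /= ph_h.
  by rewrite !boundary_period_index // phase0 leNgt ph_h /=; apply/eqP; lra.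
rewrite -leNgt => ah.
have /allP ph_bounds : all (fun x => 0 < x <= 1 / 2) ph.
  by rewrite /ph all_map; elim: (reqs) => //= p s ->; rewrite phase_bounds.
move: (perm_mem ph_perm) ph_sorted; case: (tsort ph).1 => [|h0 hs] ph_mem /= ph_path.
  by rewrite -ph_mem in a_ph.
have h0_le x : x \in ph -> h0 <= x.
  rewrite -ph_mem inE => /predU1P[-> // | ].
  by move: (order_path_min le_trans ph_path) => /allP; apply.
have h0h : h0 <= h := le_trans (h0_le _ a_ph) ah.
have hs_h : has (fun x => h < x) hs.
  apply/hasP; exists b => //; move: b_ph; rewrite -ph_mem inE => /predU1P[bh0 | //].
  by rewrite bh0 ltNge h0h in hb.
have [c [c_mid h0c /hasP[b' b'_hs cb'] /allP c_all]] :=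
  midpoints_separate ph_path h0h hs_h.
exists c; first by rewrite inE c_mid orbT.
(* Phases lie in [(0, 1/2]], and c is at least the phase [h0] and less than the phase [b']. *)
have cP : 0 <= c < 1 / 2.
  have := ph_bounds h0; rewrite -ph_mem inE eqxx => /(_ isT).
  by have := ph_bounds b'; rewrite -ph_mem inE b'_hs orbT => /(_ isT); lra.
exists (h - c); have : all (fun x => (x <= h) == (x <= c)) ph.
  by apply/allP => x; rewrite -ph_mem => /c_all.
rewrite all_map; apply: sub_all => p /= /eqP pE.
by rewrite !boundary_period_index // pE; apply/eqP; lra.
Qed.

(** * The search for the best offset *)

Lemma uniform_offsets_list (R : realType) (r k : nat) :
  (k < r)%N -> uniform_offset R r k \in offset_list (uniform_offsets R r).
Proof.
rewrite /uniform_offsets /offset_list tmapE /= inE.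
case: k => [|k] kr; first by rewrite /uniform_offset mul0r eqxx.
apply/orP; right; apply/mapP; exists k.+1 => //.
by rewrite mem_iota; lia.
Qed.

Lemma best_ofP (R : realType) (repair : repair_algorithm R) (G : metric_graph R)
    (reqs : seq (request G)) (s : R) best (cs : seq R)
    (out := fun c => (trim_and_repair repair reqs s c).1) :
  exists x, [/\ (best_of repair reqs s best cs).1 = x.1,
    x = best \/ (exists2 c, c \in cs & x = out c), best.2 <= x.2
    & forall c, c \in cs -> (out c).2 <= x.2].
Proof.
rewrite /out {out}; elim: cs best => [|c cs IH] best /=.
  by exists best; split=> //; left.
rewrite /bind /=; set best' := if _ then _ else _.
have [x [-> x_in best_x cs_x]] := IH best'.
have [best_best' c_best'] : best.2 <= best'.2 /\
    (trim_and_repair repair reqs s c).1.2 <= best'.2.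
  by rewrite /best'; case: ltP => [/ltW|].
exists x; split=> //.
- case: x_in => [-> | [c' c'_in ->]]; last first.
    by right; exists c'; rewrite // inE c'_in orbT.
  rewrite /best'; case: ifP => _; last by left.
  by right; exists c; rewrite // inE eqxx.
- exact: le_trans best_x.
- move=> c'; rewrite inE => /predU1P[-> | /cs_x //].
  exact: le_trans best_x.
Qed.

Lemma best_of_time (R : realType) (repair : repair_algorithm R)
    (G : metric_graph R) (reqs : seq (request G)) (s : R) best cs T :
  (forall c, (trim_and_repair repair reqs s c).2 <= T)%N ->
  ((best_of repair reqs s best cs).2 <= size cs * T.+1)%N.
Proof.
move=> leT; elim: cs best => [|c cs IH] best //=; rewrite /bind /=.
rewrite mulSn addnA; apply: leq_add (IH _).
by rewrite addn1 ltnS; exact: leT.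
Qed.

Lemma speedupP (R : realType) (repair : repair_algorithm R) (G : metric_graph R)
    (reqs : seq (request G)) (s : R) (cs := offset_list (offsets reqs s))
    (out := fun c => (trim_and_repair repair reqs s c).1) :
  exists c, [/\ c \in cs, (speedup repair reqs s).1 = (out c).1
    & forall c', c' \in cs -> (out c').2 <= (out c).2].
Proof.
rewrite /speedup /bind /=.
have [x [-> x_in first_x cs_x]] := best_ofP repair reqs s
  (out (offsets reqs s).1.1) (offsets reqs s).1.2.
have {x_in}[c c_cs xc] : exists2 c, c \in cs & x = out c.
  case: x_in => [-> | [c c_in ->]].
    by exists (offsets reqs s).1.1; rewrite // inE eqxx.
  by exists c; rewrite // inE c_in orbT.
exists c; rewrite -xc; split=> // c'; rewrite inE => /predU1P[-> // | ].
exact: cs_x.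
Qed.

Lemma trim_and_repairE (R : realType) (repair : repair_algorithm R)
    (G : metric_graph R) (reqs : seq (request G)) (s h : R) :
  trim_and_repair repair reqs s h =
  ((repair G [seq trim h p | p <- reqs] s).1,
   size reqs + (repair G [seq trim h p | p <- reqs] s).2)%N.
Proof. by rewrite /trim_and_repair tmapE. Qed.

(** Chains the guarantee of REPAIR at c, the maximality of the reported profit, and the gain in
    passing from trimmed to full windows. *)
Lemma speedup_ge (R : realType) (cls : graph_class) (gamma : R)
    (repair : repair_algorithm R) (G : metric_graph R) (reqs : seq (request G))
    (s c : R) (rho : run G) :
  repair_approximates cls gamma repair -> in_class cls G ->
  unit_windows reqs -> 0 < s ->
  c \in offset_list (offsets reqs s) -> has_speed s rho ->
  profit [seq trim c p | p <- reqs] rho / gamma <=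
    profit reqs (speedup repair reqs s).1.
Proof.
move=> repair_gamma inG unit_w s0 c_in speed_s.
have [c' [_ -> /(_ c c_in)]] := speedupP repair reqs s.
rewrite !trim_and_repairE /= => cc'.
have repair_c h := repair_gamma G _ s inG (trimmed_trim h unit_w) s0.
have [_ c_profit /(_ rho speed_s) le_c] := repair_c c.
have [_ c'_profit _] := repair_c c'.
apply: le_trans le_c _; rewrite -c_profit; apply: le_trans cc' _.
by rewrite c'_profit; exact: profit_trim_le.
Qed.

Lemma speedup_speed (R : realType) (cls : graph_class) (gamma : R)
    (repair : repair_algorithm R) (G : metric_graph R) (reqs : seq (request G))
    (s : R) :
  repair_approximates cls gamma repair -> in_class cls G ->
  unit_windows reqs -> 0 < s -> has_speed s (speedup repair reqs s).1.
Proof.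
move=> repair_gamma inG unit_w s0.
have [c [_ -> _]] := speedupP repair reqs s; rewrite trim_and_repairE.
by have [] := repair_gamma G _ s inG (trimmed_trim c unit_w) s0.
Qed.

(** * The approximation ratio *)

(** The limit of approximations to s within [1 / n], by the Archimedean property. *)
Lemma le_mul_of_approx (R : realType) (s a b : R) :
  (forall n : nat, (0 < n)%N ->
    exists s', s - n%:R^-1 <= s' /\ s' * a <= b) ->
  0 <= a -> s * a <= b.
Proof.
move=> approx a0; rewrite leNgt; apply/negP => lt_b.
have gap0 : 0 < s * a - b by rewrite subr_gt0.
(* Chosen so that [a / n] is below the gap [s * a - b]. *)
pose n := (Num.truncn (a / (s * a - b))).+1.
have n_gt : a / (s * a - b) < n%:R by apply: truncnS_gt.
have n0 : 0 < n%:R :> R by rewrite ltr0n.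
have [s' [ss' s'b]] := approx n isT.
have := ler_wpM2r a0 ss'; rewrite mulrBl => h.
rewrite ltr_pdivrMr // in n_gt.
have : a < a; last by rewrite ltxx.
apply: lt_le_trans n_gt _; rewrite -ler_pdivlMl //.
by lra.
Qed.

Lemma exists_offset_uniform (R : realType) (G : metric_graph R)
    (reqs : seq (request G)) (s : R) (rho : run G) (r : nat) :
  2 <= s <= 4 -> unit_windows reqs -> has_speed 1 rho ->
  (find_den s 1 (size reqs).-1).1 = Some r ->
  exists2 c, c \in offset_list (offsets reqs s) & exists rho',
    has_speed s rho' /\
    s / 4 * profit reqs rho <= profit [seq trim c p | p <- reqs] rho'.
Proof.
move=> s24 unit_w speed1 den_r.
have /find_den_some[/andP[r0 _] sr_int _] := den_r.
have rR : 0 < r%:R :> R by rewrite ltr0n.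
have [q sr] : exists q : nat, s * r%:R = q%:R.
  have /intrP[[q|q] sr] := sr_int; first by exists q.
  have : 0 < s * r%:R by rewrite mulr_gt0 //; lra.
  by rewrite sr ltr0z.
have qr : (2 * r <= q <= 4 * r)%N.
  by rewrite -!(ler_nat R) !natrM -sr !ler_pM2r.
have [k [rho' rho'P]] := exists_uniform_offset r0 qr sr unit_w speed1.
exists (uniform_offset R r k); last by exists rho'.
rewrite /offsets /offset_list /bind /= den_r; exact: uniform_offsets_list.
Qed.

Lemma exists_offset_canonical (R : realType) (G : metric_graph R)
    (reqs : seq (request G)) (s : R) (rho : run G) (n : nat) :
  2 <= s <= 4 -> unit_windows reqs -> has_speed 1 rho -> (0 < n)%N ->
  (find_den s 1 (size reqs).-1).1 = None ->
  exists2 c, c \in offset_list (offsets reqs s) & exists rho' s',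
    [/\ has_speed s rho', s - n%:R^-1 <= s' &
    s' / 4 * profit reqs rho <= profit [seq trim c p | p <- reqs] rho'].
Proof.
move=> s24 unit_w speed1 n0 den_none.
have nR : 0 < n%:R :> R by rewrite ltr0n.
(* [q / n] is the largest multiple of [1 / n] not above s: a run of that speed also has speed s, and
   [2 <= s] still gives [2 * n <= q]. *)
pose q := Num.truncn (s * n%:R).
have sn0 : 0 <= s * n%:R by rewrite mulr_ge0; lra.
have /andP[q_le q_gt] := truncn_itv sn0; rewrite -/q in q_le q_gt.
pose s' : R := q%:R / n%:R.
have s'n : s' * n%:R = q%:R by rewrite divfK ?gt_eqF.
have qn : (2 * n <= q <= 4 * n)%N.
  apply/andP; split.
    rewrite -ltnS -(ltr_nat R) natrM; apply: le_lt_trans q_gt.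
    by rewrite ler_pM2r //; lra.
  rewrite -(ler_nat R) natrM; apply: le_trans q_le _.
  by rewrite ler_pM2r //; lra.
have [k [rho' [speed_s' rho'P]]] := exists_uniform_offset n0 qn s'n unit_w speed1.
have hP : 0 <= uniform_offset R n k < 1 / 2.
  rewrite /uniform_offset divr_ge0 ?mulr_ge0 //= ltr_pdivrMr ?mulr_gt0 //.
  by have := ltn_ord k; rewrite -(ltr_nat R); lra.
have [c c_in [d c_d]] := canonical_offsets_cover reqs hP.
have speed_s : has_speed s rho'.
  by apply: has_speed_le speed_s'; rewrite /s' ler_pdivrMr.
have [rho'' [speed_s'' rho''P]] := profit_trim_shift unit_w speed_s c_d.
exists c; first by rewrite /offsets /offset_list /bind /= den_none.
exists rho'', s'; split=> //; last exact: le_trans rho''P.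
rewrite /s' ler_pdivlMr // mulrBl mulVf ?gt_eqF //.
by move: q_gt; rewrite -natr1; lra.
Qed.

Lemma profit_ge0 (R : realType) (G : metric_graph R) (reqs : seq (request G))
    (rho : run G) :
  unit_windows reqs -> 0 <= profit reqs rho.
Proof.
move=> unit_w; rewrite -(map_id reqs) profit_mapE; apply: sumr_ge0 => i _.
by have [gain0 _] := unit_windowsP i unit_w; case: ifP.
Qed.

Lemma speedup_approximates (R : realType) (cls : graph_class) (gamma : R)
    (repair : repair_algorithm R) (G : metric_graph R) (reqs : seq (request G))
    (s : R) (rho : run G) :
  1 <= gamma -> repair_approximates cls gamma repair -> in_class cls G ->
  unit_windows reqs -> 2 <= s <= 4 -> has_speed 1 rho ->
  s / (4 * gamma) * profit reqs rho <= profit reqs (speedup repair reqs s).1.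
Proof.
move=> gamma1 repair_gamma inG unit_w s24 speed1.
have s0 : 0 < s by lra.
have gamma0 : 0 < gamma by lra.
have ge c rho' s' : c \in offset_list (offsets reqs s) -> has_speed s rho' ->
    s' / 4 * profit reqs rho <= profit [seq trim c p | p <- reqs] rho' ->
    s' * (profit reqs rho / (4 * gamma)) <= profit reqs (speedup repair reqs s).1.
  move=> c_in speed_s le_c.
  apply: le_trans (speedup_ge repair_gamma inG unit_w s0 c_in speed_s).
  rewrite ler_pdivlMr //; apply: le_trans le_c.
  by rewrite le_eqVlt; apply/orP; left; apply/eqP; field; rewrite gt_eqF.
have -> : s / (4 * gamma) * profit reqs rho = s * (profit reqs rho / (4 * gamma)).
  by ring.
case den : (find_den s 1 (size reqs).-1).1 => [r|].
  have [c c_in [rho' [speed_s le_c]]] := exists_offset_uniform s24 unit_w speed1 den.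
  exact: ge c_in speed_s le_c.
(* The offset and the run depend on n, but the output of SPEEDUP does not, so the limit can be
   taken. *)
apply: le_mul_of_approx => [n n0|]; last first.
  by rewrite divr_ge0 ?profit_ge0 ?mulr_ge0 // ltW.
have [c c_in [rho' [s' [speed_s ss' le_c]]]] :=
  exists_offset_canonical s24 unit_w speed1 n0 den.
by exists s'; split=> //; exact: ge c_in speed_s le_c.
Qed.

(** * The running time *)

(** A successful search stops at the denominator it finds, so started at 1 it costs exactly d
    steps. *)
Lemma find_den_time (R : realType) (s : R) (r k : nat) :
  ((find_den s r k).2 <= k)%N /\
  forall d, (find_den s r k).1 = Some d -> ((find_den s r k).2 + r)%N = d.+1.
Proof.
elim: k r => [|k IH] r //=; rewrite /bind /=; case: ifP => _ /=.
  by split=> // d [<-]; rewrite add1n.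
have [le_k eq_d] := IH r.+1; split; first by rewrite add1n ltnS.
by move=> d /eq_d; rewrite addnS add1n addSn.
Qed.

(** Uniform case: r steps of search and [r - 1] for the offsets. Canonical case: at most [m - 1] for
    the failed search, m for the phases, [m * m] for sorting and [m - 1] for the midpoints. *)
Lemma offsets_time (R : realType) (G : metric_graph R) (reqs : seq (request G))
    (s : R) (m := size reqs) (N := (offsets reqs s).2)
    (len := size (offset_list (offsets reqs s))) :
  (0 < m)%N ->
  if (find_den s 1 m.-1).1 is Some r then (N <= 2 * r)%N /\ len = r
  else (N <= m * (m + 3))%N /\ len = m.
Proof.
rewrite /N /len /m /offsets /bind /= => m0.
have [time_le time_eq] := find_den_time s 1 (size reqs).-1.
case den : (find_den _ _ _).1 => [r|].
  have /find_den_some[/andP[r0 _] _ _] := den.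
  have := time_eq r den; rewrite /uniform_offsets /offset_list tmapE /=.
  by rewrite size_map size_iota; move: (find_den _ _ _).2; lia.
rewrite /canonical_offsets /offset_list tmapE /=; set ph := map _ _.
have ph_size : size ph = size reqs by rewrite size_map.
have := tsort_time ph; have := perm_size (tsort_correct ph).1.
rewrite ph_size; case: (tsort ph).1 => [|h hs] /= sz; first by rewrite -sz in m0.
have [-> ->] := midpoints_size h hs.
by move: (find_den _ _ _).2 (tsort _).2 time_le; split; nia.
Qed.

Lemma speedup_time (R : realType) (cls : graph_class) (M Gamma : nat -> nat)
    (repair : repair_algorithm R) (G : metric_graph R) (reqs : seq (request G))
    (s : R) :
  repair_runs_in cls M Gamma repair -> in_class cls G -> unit_windows reqs ->
  0 < s -> (0 < size reqs <= M #|vertex G|)%N ->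
  ((speedup repair reqs s).2 <= 10 *
    (odflt (size reqs) (find_den s 1 (size reqs).-1).1 * Gamma #|vertex G|))%N.
Proof.
move=> repair_Gamma inG unit_w s0 /andP[m0 mM].
set g := Gamma _.
have repair_time h : (size reqs <= (repair G [seq trim h p | p <- reqs] s).2)%N /\
    ((repair G [seq trim h p | p <- reqs] s).2 <= g)%N.
  have [] := repair_Gamma G _ s inG (trimmed_trim h unit_w) s0.
  by rewrite size_map => ? /(_ mM).
(* REPAIR reads all requests, so m is at most [Gamma]; this absorbs the trimming for each offset and
   the quadratic sort. *)
have mg : (size reqs <= g)%N.
  by have [le1 le2] := repair_time 0; exact: leq_trans le2.
have time_c c : ((trim_and_repair repair reqs s c).2 <= 2 * g)%N.
  rewrite trim_and_repairE /=; have [_] := repair_time c.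
  by move: (repair _ _ _).2; lia.
have -> : (speedup repair reqs s).2 = ((offsets reqs s).2 +
    ((trim_and_repair repair reqs s (offsets reqs s).1.1).2 +
     (best_of repair reqs s (trim_and_repair repair reqs s (offsets reqs s).1.1).1
        (offsets reqs s).1.2).2))%N by [].
have := offsets_time s m0.
have := best_of_time (trim_and_repair repair reqs s (offsets reqs s).1.1).1
  (offsets reqs s).1.2 time_c.
have := time_c (offsets reqs s).1.1.
have -> : size (offset_list (offsets reqs s)) = (size (offsets reqs s).1.2).+1 by [].
move: (best_of _ _ _ _ _).2 (trim_and_repair _ _ _ _).2 (offsets _ _).2 => a b N.
move: (size (offsets reqs s).1.2) => l.
case: (find_den _ _ _).1 => [r|] /= b_le a_le [N_le lenE].
  by rewrite -lenE in N_le *; nia.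
by rewrite -lenE in N_le mg *; nia.
Qed.

Theorem theorem3 (R : realType) (cls : graph_class) (gamma : R)
    (M Gamma : nat -> nat) (repair : repair_algorithm R)
    (gamma_ge1 : 1 <= gamma)
    (repair_gamma : repair_approximates cls gamma repair)
    (repair_Gamma : repair_runs_in cls M Gamma repair) :
  (forall (G : metric_graph R) (reqs : seq (request G)) (s : R),
     in_class cls G -> unit_windows reqs -> 2 <= s <= 4 ->
     let rho := (speedup repair reqs s).1 in
     has_speed s rho /\
     forall Rstar : run G, optimal reqs 1 Rstar ->
       s / (4 * gamma) * profit reqs Rstar <= profit reqs rho) /\
  (exists C : nat,
   forall (G : metric_graph R) (reqs : seq (request G)) (s : R),
     in_class cls G -> unit_windows reqs -> 2 <= s <= 4 ->
     (0 < size reqs <= M #|vertex G|)%N ->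
     let time := (speedup repair reqs s).2 in
     (forall x : rat, s = ratr x ->
        (time <= C * (minn `|denq x| (size reqs) * Gamma #|vertex G|))%N) /\
     (irrational s ->
        (time <= C * (size reqs * Gamma #|vertex G|))%N)).
Proof.
split=> [G reqs s inG unit_w s24 | ].
  split=> [|Rstar [speed1 _]].
    by apply: (speedup_speed repair_gamma inG unit_w); lra.
  exact: (speedup_approximates gamma_ge1 repair_gamma inG unit_w s24 speed1).
exists 10%N => G reqs s inG unit_w s24 mM.
have s0 : 0 < s by lra.
have := speedup_time repair_Gamma inG unit_w s0 mM.
case den : (find_den _ _ _).1 => [r|] /= time_le; split=> [x sx | irr].
- have /find_denP[rm [x' [sx' x'r]]] := den.
  have /fmorph_inj xx' : ratr x = ratr x' :> R by rewrite -sx.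
  by rewrite xx' x'r /= (minn_idPl (ltnW rm)).
- have /find_denP[_ [x [sx _]]] := den.
  by case: irr; exists x.
(* The failed search shows that the denominator of s is at least m, so the minimum is m. *)
- rewrite (minn_idPr _) //; rewrite leqNgt; apply/negP => lt_m.
  have /find_denP : (`|denq x| < size reqs)%N /\
      exists x', s = ratr x' /\ denq x' = `|denq x|%N%:Z.
    by split=> //; exists x; rewrite absz_denq.
  by rewrite den.
- by [].
Qed.
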